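(* Let $d\ge 2$ be a nonsquare integer, let $(X_1,Y_1)$ be the fundamental solution of $x^2-dy^2=1$, and let $K$ be an integer with $K>X_1$. Let $A$ (respectively $B$) be the sum of the $x$-coordinates (respectively $y$-coordinates) of all integer solutions $(x,y)$ of $x^2-dy^2=1$ with $0\le x,y<K$. For $j\ge1$, define $$R_j=\frac{4^j}{\binom{2j}{j}},\qquad \omega=\frac{R_{dK}}{R_K}.$$ Then $$A=\lfloor\omega B\rfloor+2,\qquad B=\lfloor A/\omega\rfloor.$$
   Context: The fundamental solution $(X_1,Y_1)$ of $x^2-dy^2=1$ is the solution in integers $X_1,Y_1>0$ with $X_1$ least. *)

(* Defs.v *)
From mathcomp Require Import all_boot all_order all_algebra.

Set Implicit Arguments.
Unset Strict Implicit.
Unset Printing Implicit Defensive.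

Import Order.TTheory GRing.Theory Num.Theory.
Local Open Scope ring_scope.

Definition pell_sol (d x y : int) : bool := x ^+ 2 - d * y ^+ 2 == 1.

Definition fundamental_sol (d X Y : int) : Prop :=
  [/\ 0 < X, 0 < Y, pell_sol d X Y &
      forall x y : int, 0 < x -> 0 < y -> pell_sol d x y -> X <= x].

(* The integers x with 0 <= x < K are represented by 'I_K. *)
Definition pell_xsum (d K : nat) : int :=
  \sum_(p : 'I_K * 'I_K | pell_sol d p.1 p.2) (p.1 : nat)%:Z.

Definition pell_ysum (d K : nat) : int :=
  \sum_(p : 'I_K * 'I_K | pell_sol d p.1 p.2) (p.2 : nat)%:Z.

(* Every R_j is rational, so exact arithmetic in rat suffices. *)
Definition Rcb (j : nat) : rat := (4 ^ j)%:R / 'C(2 * j, j)%:R.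

Definition omega (d K : nat) : rat := Rcb (d * K) / Rcb K.

(* Main.v *)
Require Import Defs.
From mathcomp Require Import all_boot all_order all_algebra.
From mathcomp Require Import ring lra zify.

Set Implicit Arguments.
Unset Strict Implicit.
Unset Printing Implicit Defensive.

Import Order.TTheory GRing.Theory Num.Theory.
Local Open Scope ring_scope.

(** Write s for the square root of d and e = X1 + Y1 s.  The solutions with
    nonnegative coordinates are given by x_n + y_n s = e ^ n, so that
    A = x_0 + ... + x_N and B = y_0 + ... + y_N, where N is the last index
    with x_N < K; as X1 < K, N is at least 1.  Then
    A - s B = 1 + e^-1 + ... + e^-N lies strictly between 1 and
    1 / (1 - e^-1), which is at most 1.37 as e >= 2 + sqrt 3.

    The number omega is slightly smaller than s.  Since R_j ^ 2 lies between
    pi j and pi (j + 1/3), and more precisely R_j ^ 2 / j decreases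
    while R_j ^ 2 / (3 j + 1) increases, 3dK / (3K + 1) <= omega ^ 2 <= d
    ([omega_sqr_ge], [omega_sqr_le]).  As s B is about A < 1.37 K, replacing s
    by omega increases A - s B by a bounded, small amount.  What is needed is
    1 < A - omega B <= 2 for the first formula, and 0 <= A - omega B < omega
    for the second.

    No irrational number is used.  After squaring, the three inequalities
    A - omega B > 1, A - omega B < omega and A - omega B <= 2 follow from
    inequalities between integers ([floor_of_sqr_bounds]).  To prove the latter,
    let (x, y) = (x_N, y_N) be the last solution.  Reversing the order of
    summation turns the sum of the e ^ n into e ^ N times the sum of the
    e ^ -n, that is,
      A + s B = (x + y s) (A - s B).
    Comparing coordinates gives (x - 1) A = d y B and (x + 1) B = y A
    ([pell_sum_xy]), hence (x - 1) A ^ 2 = d (x + 1) B ^ 2.  This exact value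
    of A ^ 2 / (d B ^ 2), the bound x + 1 <= K and linear upper bounds for A and
    B in terms of x and y turn the three inequalities into polynomial ones
    ([sqr_bounds]). *)

(** * Solutions as powers of the fundamental one *)

(** The coordinates of [(X + Y sqrt d) ^ n]. *)
Fixpoint pell (d X Y : int) (n : nat) : int * int :=
  if n is m.+1 then
    let: (x, y) := pell d X Y m in (X * x + d * Y * y, Y * x + X * y)
  else (1, 0).

Lemma pellS d X Y n :
  pell d X Y n.+1 = (X * (pell d X Y n).1 + d * Y * (pell d X Y n).2,
                     Y * (pell d X Y n).1 + X * (pell d X Y n).2).
Proof. by rewrite /=; case: (pell d X Y n). Qed.

Lemma pell_solP (d X Y : int) n :
  pell_sol d X Y -> pell_sol d (pell d X Y n).1 (pell d X Y n).2.
Proof.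
rewrite /pell_sol => /eqP h; elim: n => [|n /eqP IH].
  by apply/eqP => /=; ring.
rewrite pellS /=; case: (pell d X Y n) IH => x y /= IH; apply/eqP.
rewrite -[RHS]mulr1 -{1}h -IH; ring.
Qed.

Lemma pell_ge0 (d X Y : int) n : 0 <= d -> 0 < X -> 0 < Y ->
  0 < (pell d X Y n).1 /\ 0 <= (pell d X Y n).2.
Proof.
move=> d0 X0 Y0; elim: n => [//|n]; rewrite pellS /=.
case: (pell d X Y n) => x y /= [x0 y0]; split.
  by apply: ltr_wpDr; rewrite ?mulr_gt0 ?mulr_ge0 // ltW.
by rewrite addr_ge0 ?mulr_ge0 // ltW.
Qed.

Lemma pell_lt (d X Y : int) n : 0 <= d -> 1 < X -> 0 < Y ->
  (pell d X Y n).1 < (pell d X Y n.+1).1.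
Proof.
move=> d0 X1 Y0; rewrite pellS /=.
have [|x0 y0] := @pell_ge0 d X Y n d0 _ Y0; first by lia.
have : 0 <= d * Y * (pell d X Y n).2 by rewrite !mulr_ge0 // ltW.
nia.
Qed.

Lemma ltn_pell (d X Y : int) n : 0 <= d -> 1 < X -> 0 < Y ->
  n%:Z < (pell d X Y n).1.
Proof.
move=> d0 X1 Y0; elim: n => [//|n IH].
have := @pell_lt d X Y n d0 X1 Y0; lia.
Qed.

Lemma pell_mono (d X Y : int) : 0 <= d -> 1 < X -> 0 < Y ->
  {mono (fun n => (pell d X Y n).1) : m n / (m <= n)%N >-> m <= n}.
Proof.
move=> d0 X1 Y0; apply: le_mono => m n; rewrite ltEnat /=.
elim: n => [//|n IH]; rewrite ltnS leq_eqVlt => /predU1P[->|/IH h].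
  exact: pell_lt.
exact: lt_trans h (pell_lt _ _ _ _).
Qed.

Lemma fundamental_gt1 (d X Y : int) : 0 < d ->
  0 < X -> 0 < Y -> pell_sol d X Y -> 1 < X.
Proof.
move=> d0 X0 Y0 /eqP h.
have : 0 < d * Y ^+ 2 by rewrite mulr_gt0 ?exprn_gt0.
nia.
Qed.

(** Infinite descent: dividing [x + y sqrt d] by [X + Y sqrt d] gives a
    solution with nonnegative coordinates and a smaller [y].  Minimality of [X]
    is what keeps the new second coordinate nonnegative. *)
Lemma pell_sol_is_power (d X Y x y : int) : 0 < d ->
  fundamental_sol d X Y -> 0 < x -> 0 <= y -> pell_sol d x y ->
  exists n, pell d X Y n = (x, y).
Proof.
move=> d0 [X0 Y0 hXY hmin].
have hX1 := fundamental_gt1 d0 X0 Y0 hXY.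
have [k] := ubnP `|y|%N; elim: k x y => [//|k IH] x y yk x0 y0 hs.
have [y_eq0|y_neq0] := eqVneq y 0.
  exists 0%N; move: hs; rewrite y_eq0 /pell_sol => /eqP hs.
  by congr (_, _); nia.
have yp : 0 < y by lia.
have hXx := hmin x y x0 yp hs.
move/eqP: hXY => hN; move/eqP: hs => hn.
have EX : X ^+ 2 = 1 + d * Y ^+ 2 by lra.
have Ex : x ^+ 2 = 1 + d * y ^+ 2 by lra.
have dYy0 : 0 < d * Y * y by rewrite !mulr_gt0.
have Yy : Y <= y.
  rewrite -(@ler_pXn2r _ 2) ?nnegrE ?(ltW Y0) ?(ltW yp) //.
  rewrite -(ler_pM2l d0).
  have := @ler_pXn2r _ 2 isT X x.
  rewrite !nnegrE (ltW X0) (ltW x0) => /(_ isT isT).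
  by rewrite hXx; lra.
have x'0 : 0 < X * x - d * Y * y.
  rewrite subr_gt0 -(@ltr_pXn2r _ 2) ?nnegrE ?mulr_ge0 //;
    rewrite ?(ltW X0) ?(ltW Y0) ?(ltW d0) ?(ltW x0) //.
  have -> : (X * x) ^+ 2 = (d * Y * y) ^+ 2 + d * Y ^+ 2 + x ^+ 2.
    transitivity (d * Y ^+ 2 * x ^+ 2 + x ^+ 2).
      by rewrite exprMn EX; ring.
    rewrite {1}Ex; ring.
  by have := exprn_gt0 2 x0; have := exprn_gt0 2 Y0; nia.
have y'0 : 0 <= X * y - Y * x.
  rewrite subr_ge0 -(@ler_pXn2r _ 2) ?nnegrE ?mulr_ge0 //;
    rewrite ?(ltW X0) ?(ltW Y0) ?(ltW d0) ?(ltW x0) //.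
  have -> : (X * y) ^+ 2 = (Y * x) ^+ 2 + y ^+ 2 - Y ^+ 2.
    transitivity (y ^+ 2 + d * Y ^+ 2 * y ^+ 2).
      by rewrite exprMn EX; ring.
    rewrite exprMn Ex; ring.
  have : Y ^+ 2 <= y ^+ 2 by rewrite ler_pXn2r ?nnegrE ?(ltW Y0).
  lra.
have y'y : X * y - Y * x < y.
  suff : (X - 1) * y < Y * x by lra.
  rewrite -(@ltr_pXn2r _ 2) ?nnegrE ?mulr_ge0 ?subr_ge0 //;
    rewrite ?(ltW x0) ?(ltW Y0) ?(ltW hX1) //.
  rewrite -(ltr_pM2l d0) !exprMn.
  have -> : d * (Y ^+ 2 * x ^+ 2) = (X - 1) ^+ 2 * (d * y ^+ 2)
      + (X - 1) ^+ 2 + 2 * (X - 1) * x ^+ 2.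
    rewrite mulrA (_ : d * Y ^+ 2 = X ^+ 2 - 1); last by lra.
    rewrite (_ : d * y ^+ 2 = x ^+ 2 - 1); [ring | lra].
  have : 0 < (X - 1) ^+ 2 by rewrite exprn_gt0 ?subr_gt0.
  have : 0 < 2 * (X - 1) * x ^+ 2.
    by rewrite !mulr_gt0 ?exprn_gt0 ?subr_gt0.
  lra.
have [||n hnE] := IH (X * x - d * Y * y) (X * y - Y * x) _ x'0 y'0.
- by lia.
- apply/eqP; rewrite -[RHS]mulr1 -{1}hN -hn; ring.
exists n.+1; rewrite pellS hnE /=; congr (_, _).
  transitivity ((X ^+ 2 - d * Y ^+ 2) * x); last by rewrite hN mul1r.
  ring.
transitivity ((X ^+ 2 - d * Y ^+ 2) * y); last by rewrite hN mul1r.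
ring.
Qed.

(** Every nonnegative solution is a power; first coordinates increase strictly
    along the powers and bound the second ones, so the box cuts the list of
    powers after the index [N]. *)
Lemma sum_box_pell (d K N : nat) (X Y : int) (F : int -> int -> int) :
  (0 < d)%N -> fundamental_sol d X Y ->
  (pell d X Y N).1 < K%:Z <= (pell d X Y N.+1).1 ->
  \sum_(p : 'I_K * 'I_K | pell_sol d p.1 p.2) F (p.1 : nat) (p.2 : nat) =
  \sum_(n < N.+1) F (pell d X Y n).1 (pell d X Y n).2.
Proof.
move=> d0 hf /andP[NK KN]; have [X0 Y0 hXY _] := hf.
have dz0 : 0 < d%:Z by lia.
have X1 := fundamental_gt1 dz0 X0 Y0 hXY.
have p0 n := @pell_ge0 d X Y n (ltW dz0) X0 Y0.
have pm := pell_mono (ltW dz0) X1 Y0.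
have pyx n : (pell d X Y n).2 <= (pell d X Y n).1.
  have [x0 y0] := p0 n; have /eqP hs := pell_solP n hXY.
  by rewrite -(@ler_pXn2r _ 2) ?nnegrE ?(ltW x0) //; nia.
case: K NK KN => [|K] NK KN; first by have [] := p0 N; lia.
have xK (n : 'I_N.+1) : (pell d X Y n).1 < K.+1%:Z.
  by apply: le_lt_trans NK; rewrite pm -ltnS.
pose h (n : 'I_N.+1) : 'I_K.+1 * 'I_K.+1 :=
  (inord `|(pell d X Y n).1|%N, inord `|(pell d X Y n).2|%N).
have h1 n : ((h n).1 : nat)%:Z = (pell d X Y n).1.
  have [x0 _] := p0 n; have := xK n; rewrite /h /= => ?.
  by rewrite inordK; lia.
have h2 n : ((h n).2 : nat)%:Z = (pell d X Y n).2.
  have [_ y0] := p0 n; have := xK n; have := pyx n; rewrite /h /= => ? ?.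
  by rewrite inordK; lia.
have hinj : injective h.
  move=> m n /(congr1 (fun p : 'I_K.+1 * 'I_K.+1 => (p.1 : nat)%:Z)).
  rewrite !h1 => e; apply/val_inj/eqP; rewrite /= eqn_leq -!pm /= e lexx //.
rewrite (eq_bigl (fun p => p \in [set h n | n in 'I_N.+1])); last first.
  move=> p; apply/idP/imsetP => [hs|[n _ ->]]; last first.
    by rewrite h1 h2 pell_solP.
  have px : 0 < (p.1 : nat)%:Z.
    have [e|] := eqVneq (p.1 : nat) 0%N; last by lia.
    have : 0 <= d%:Z * (p.2 : nat)%:Z ^+ 2 by rewrite mulr_ge0 ?sqr_ge0.
    move/eqP: hs; rewrite e expr0n /=. lia.
  have [n en] := pell_sol_is_power dz0 hf px (isT : 0 <= (p.2 : nat)%:Z) hs.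
  have nN : (n < N.+1)%N.
    rewrite ltnNge -pm en /= -ltNge; apply: lt_le_trans KN.
    by rewrite ltz_nat ltn_ord.
  exists (Ordinal nN) => //; case: p en {hs px} => p1 p2 /= en.
  by congr (_, _); apply: val_inj => /=; rewrite en /= inord_val.
rewrite big_imset /=; last by move=> m n _ _; apply: hinj.
by apply: eq_bigr => n _; rewrite h1 h2.
Qed.

(** * Sums of consecutive powers *)

(** This comes from summing the recurrence x_(k+1) + x_(k-1) = 2 X x_k, using
    (X - 1) (X + 1) = d Y ^ 2 to replace the denominator X - 1 by Y; once
    found, it is proved by induction. *)
Lemma pell_sum_x (d X Y : int) n : X ^+ 2 - d * Y ^+ 2 = 1 ->
  2 * Y * (\sum_(k < n.+1) (pell d X Y k).1) =
  Y * ((pell d X Y n).1 + 1) + (X + 1) * (pell d X Y n).2.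
Proof.
move=> hN; elim: n => [|n IH]; first by rewrite big_ord_recr big_ord0 /=; ring.
rewrite big_ord_recr mulrDr IH pellS /=.
case: (pell d X Y n) => x y /=.
transitivity (Y * (X * x + d * Y * y + 1) + (X + 1) * (Y * x) +
  (d * Y ^+ 2 + (X + 1)) * y); first by ring.
by rewrite (_ : d * Y ^+ 2 = X ^+ 2 - 1); [ring | lra].
Qed.

Lemma pell_sum_y (d X Y : int) n : X ^+ 2 - d * Y ^+ 2 = 1 ->
  2 * d * Y * (\sum_(k < n.+1) (pell d X Y k).2) =
  d * Y * (pell d X Y n).2 + (X + 1) * ((pell d X Y n).1 - 1).
Proof.
move=> hN; elim: n => [|n IH]; first by rewrite big_ord_recr big_ord0 /=; ring.
rewrite big_ord_recr mulrDr IH pellS /=.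
case: (pell d X Y n) => x y /=.
transitivity (d * Y * (Y * x + X * y) + (X + 1) * (x - 1) + (X + 1) * d * Y * y
  + d * Y ^+ 2 * x); first by ring.
by rewrite (_ : d * Y ^+ 2 = X ^+ 2 - 1); [ring | lra].
Qed.

(** The reversal symmetry A + s B = (x + y s) (A - s B), with s = sqrt d, read
    on coordinates. *)
Lemma pell_sum_xy (d X Y : int) n (x := (pell d X Y n).1)
    (y := (pell d X Y n).2) (A := \sum_(k < n.+1) (pell d X Y k).1)
    (B := \sum_(k < n.+1) (pell d X Y k).2) :
  0 < d -> 0 < Y -> pell_sol d X Y ->
  (x - 1) * A = d * y * B /\ (x + 1) * B = y * A.
Proof.
move=> d0 Y0 hs; have /eqP hn := pell_solP n hs; move/eqP: hs => hN.
have eA := pell_sum_x n hN; have eB := pell_sum_y n hN.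
rewrite -/x -/y -/A -/B in hn eA eB; move: x y A B hn eA eB => x y A B hn eA eB.
have ey : d * y ^+ 2 = x ^+ 2 - 1 by lra.
have Yn0 : Y != 0 by rewrite gt_eqF.
split.
  apply: (@mulfI _ (2 * Y)); first by rewrite mulf_neq0.
  transitivity ((x - 1) * (2 * Y * A)); first by ring.
  transitivity (y * (2 * d * Y * B)); last by ring.
  rewrite eA eB; transitivity (Y * (x ^+ 2 - 1) + (x - 1) * (X + 1) * y).
    by ring.
  rewrite -ey; ring.
apply: (@mulfI _ (2 * d * Y)); first by rewrite !mulf_neq0 // gt_eqF.
transitivity ((x + 1) * (2 * d * Y * B)); first by ring.
transitivity (d * y * (2 * Y * A)); last by ring.
rewrite eA eB; transitivity (d * Y * y * (x + 1) + (X + 1) * (x ^+ 2 - 1)).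
  by ring.
rewrite -ey; ring.
Qed.

Lemma pell_sum_x_ge (d X Y : int) n : 0 <= d -> 0 < X -> 0 < Y ->
  (pell d X Y n.+1).1 + 1 <= \sum_(k < n.+2) (pell d X Y k).1.
Proof.
move=> d0 X0 Y0; rewrite big_ord_recr addrC lerD2r big_ord_recl.
rewrite lerDl sumr_ge0 // => k _; apply: ltW.
by have [] := @pell_ge0 d X Y (bump 0 k) d0 X0 Y0.
Qed.

(** * Estimates for the two sums *)

(** By both Pell equations the square of [(X + 1) y / (Y x)] is less than
    [(X + 1) / (X - 1)], which is at most 3 as [X >= 2]; and 7/4 is a rational
    upper bound for [sqrt 3].  This bounds the second term of [pell_sum_x]. *)
Lemma fundamental_ratio_ub (d X Y x y : int) :
  0 < d -> 1 < X -> 0 < Y -> 0 < x -> 0 <= y ->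
  X ^+ 2 - d * Y ^+ 2 = 1 -> x ^+ 2 - d * y ^+ 2 = 1 ->
  4 * (X + 1) * y <= 7 * Y * x.
Proof.
move=> d0 X1 Y0 x0 y0 hN hn.
rewrite -(@ler_pXn2r _ 2) ?nnegrE ?mulr_ge0 //; [|lia|lia|lia].
rewrite -(ler_pM2l d0) !exprMn.
have -> : d * (4 ^+ 2 * (X + 1) ^+ 2 * y ^+ 2)
    = 16 * (X + 1) ^+ 2 * (x ^+ 2 - 1).
  rewrite (_ : x ^+ 2 = 1 + d * y ^+ 2); [ring | lra].
have -> : d * (7 ^+ 2 * Y ^+ 2 * x ^+ 2) = 49 * (X - 1) * (X + 1) * x ^+ 2.
  transitivity (49 * (d * Y ^+ 2) * x ^+ 2); first by ring.
  rewrite (_ : d * Y ^+ 2 = X ^+ 2 - 1); [ring | lra].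
have : 0 <= (49 * (X - 1) - 16 * (X + 1)) * ((X + 1) * x ^+ 2).
  by rewrite !mulr_ge0 ?exprn_ge0 //; lia.
have : 0 <= (X + 1) ^+ 2 by rewrite exprn_ge0 //; lia.
lra.
Qed.

(** After squaring and cancelling [X + 1], this is [X + 1 <= d (X - 1)].  It
    could only fail for [d = X = 2], where the equation has no solution.  It
    bounds the second term of [pell_sum_y]. *)
Lemma fundamental_le_dY (d X Y : int) : 2 <= d -> 1 < X -> 0 < Y ->
  X ^+ 2 - d * Y ^+ 2 = 1 -> X + 1 <= d * Y.
Proof.
move=> d2 X1 Y0 hN.
have hX : X + 1 <= d * (X - 1).
  have [X_eq2|X_ne2] := eqVneq X 2; last by nia.
  have d_ne2 : d <> 2.
    by move=> d_eq2; move: hN; rewrite X_eq2 d_eq2; move: (Y ^+ 2) => z; lia.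
  rewrite X_eq2; lia.
rewrite -(@ler_pXn2r _ 2) ?nnegrE ?mulr_ge0 //; [|lia|lia|lia].
rewrite exprMn.
have -> : d ^+ 2 * Y ^+ 2 = d * (X - 1) * (X + 1).
  transitivity (d * (d * Y ^+ 2)); first by ring.
  rewrite (_ : d * Y ^+ 2 = X ^+ 2 - 1); [ring | lra].
by rewrite expr2 ler_wpM2r //; lia.
Qed.

(** The left-hand side minus the right-hand side is convex in [B], and negative
    at 0, so only the extreme value [B = (x + y - 1) / 2] matters.  The slack is
    small: for [d = 2], B / x tends to (1 + 1 / sqrt 2) / 2 = 0.8535..., against
    the critical value 6/7 = 0.8571... *)
Lemma pell_ysum_quadratic (x y B : int) : 2 <= x -> 0 <= y -> 0 <= B ->
  2 * y ^+ 2 <= x ^+ 2 - 1 -> 2 * B <= x + y - 1 ->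
  7 * B ^+ 2 < (6 * B + 3) * (x - 1).
Proof.
move=> x2 y0 B0 hy hB.
have [h|h] := leP (7 * y) (5 * (x - 1)); first by nia.
suff : (x + y - 1) * (7 * y - 5 * (x - 1)) < 12 * (x - 1) by nia.
have : 4 * y < 3 * x by nia.
nia.
Qed.

(** For large [x] only the leading terms matter, and 11/8 is well below
    the critical value 12/7 of A / x. *)
Lemma pell_xsum_quadratic (x A : int) :
  2 <= x -> x + 1 <= A -> 8 * A <= 11 * x + 4 ->
  7 * A ^+ 2 <= 4 * (A - 1) * (3 * x + 4).
Proof. move=> x2 hA hA8. nia. Qed.

(** Squared forms of omega B < A - 1, A < omega (B + 1) and
    A - 2 <= omega B, with omega ^ 2 replaced by [d] in the first and by
    [3dK / (3K + 1)] in the others.  By the reversal identities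
    [(x - 1) A ^ 2 = d (x + 1) B ^ 2], which eliminates [d B ^ 2] or [A ^ 2];
    the worst case for [K] is [x + 1]. *)
Lemma sqr_bounds (d K x y A B : int) :
  2 <= d -> 2 <= x -> x + 1 <= K -> 0 <= y -> 0 <= B ->
  x ^+ 2 - d * y ^+ 2 = 1 ->
  (x - 1) * A = d * y * B -> (x + 1) * B = y * A ->
  x + 1 <= A -> 8 * A <= 11 * x + 4 -> 2 * B <= x + y - 1 ->
  [/\ d * B ^+ 2 < (A - 1) ^+ 2,
      A ^+ 2 * (3 * K + 1) < 3 * d * K * (B + 1) ^+ 2 &
      (A - 2) ^+ 2 * (3 * K + 1) <= 3 * d * K * B ^+ 2].
Proof.
move=> d2 x2 xK y0 B0 hn e1 e2 xA A8 B2.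
have E : (x - 1) * A ^+ 2 = d * (x + 1) * B ^+ 2.
  transitivity ((x - 1) * A * A); first by ring.
  rewrite e1; transitivity (d * B * (y * A)); first by ring.
  rewrite -e2; ring.
have kA := pell_xsum_quadratic x2 xA A8.
have kB : 7 * B ^+ 2 < (6 * B + 3) * (x - 1).
  by apply: (@pell_ysum_quadratic x y B) => //; nia.
have x1 : 0 < x + 1 by lia.
have x1' : 0 < x - 1 by lia.
split.
- rewrite -(ltr_pM2l x1).
  suff : 0 < 2 * A * (A - (x + 1)) + (x + 1) by lra.
  by apply: ltr_wpDl => //; rewrite !mulr_ge0 //; lia.
- have D1 : A ^+ 2 < 3 * (x + 1) * (d * (B + 1) ^+ 2 - A ^+ 2).
    rewrite -(ltr_pM2l x1').
    have : 0 < d * (x + 1) * ((6 * B + 3) * (x - 1) - 7 * B ^+ 2).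
      by rewrite !mulr_gt0 ?subr_gt0 //; lia.
    have -> : (x - 1) * (3 * (x + 1) * (d * (B + 1) ^+ 2 - A ^+ 2))
        = 3 * (x + 1) * (d * (x - 1) * (B + 1) ^+ 2 - (x - 1) * A ^+ 2) by ring.
    rewrite E; lra.
  (* So the coefficient of K is positive, and K >= x + 1 preserves D1. *)
  have D2 : 0 < d * (B + 1) ^+ 2 - A ^+ 2 by have := sqr_ge0 A; nia.
  have : 0 <= (K - (x + 1)) * (d * (B + 1) ^+ 2 - A ^+ 2).
    by rewrite mulr_ge0 //; lia.
  lra.
have D1 : (A - 2) ^+ 2 <= 3 * (x + 1) * (d * B ^+ 2 - (A - 2) ^+ 2) by lra.
have D2 : 0 <= d * B ^+ 2 - (A - 2) ^+ 2 by have := sqr_ge0 (A - 2); nia.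
have : 0 <= (K - (x + 1)) * (d * B ^+ 2 - (A - 2) ^+ 2).
  by rewrite mulr_ge0 //; lia.
lra.
Qed.

(** * Central binomial ratios and omega *)

Lemma Rcb_gt0 j : 0 < Rcb j.
Proof. by rewrite /Rcb divr_gt0 // ltr0n ?expn_gt0 // bin_gt0; lia. Qed.

Lemma bin_centralS j :
  (j.+1 * 'C(2 * j.+1, j.+1) = 2 * (2 * j).+1 * 'C(2 * j, j))%N.
Proof.
rewrite (_ : 2 * j.+1 = (2 * j).+2)%N; last by lia.
rewrite binS.
have -> : ('C((2 * j).+1, j.+1) = 'C((2 * j).+1, j))%N.
  by rewrite -bin_sub; [congr 'C(_, _); lia | lia].
have := mul_bin_left (2 * j).+1 j.
have := mul_bin_diag (2 * j).+1 j.
rewrite /=; nia.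
Qed.

(** [R_(j+1) / R_j = (2j + 2) / (2j + 1)], from which both monotonicity results
    follow. *)
Lemma RcbS j : Rcb j.+1 * (2 * j + 1)%:R = Rcb j * (2 * j + 2)%:R.
Proof.
rewrite /Rcb.
have b0 : 'C(2 * j, j)%:R != 0 :> rat by rewrite pnatr_eq0 -lt0n bin_gt0; lia.
have b1 : 'C(2 * j.+1, j.+1)%:R != 0 :> rat
  by rewrite pnatr_eq0 -lt0n bin_gt0; lia.
apply: (mulIf b0); apply: (mulIf b1).
rewrite mulrAC [in RHS]mulrAC.
transitivity ((4 ^ j.+1)%:R * (2 * j + 1)%:R * 'C(2 * j, j)%:R : rat).
  by field.
transitivity ((4 ^ j)%:R * (2 * j + 2)%:R * 'C(2 * j.+1, j.+1)%:R : rat);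
  last by field.
rewrite -!natrM; congr (_%:R).
have := bin_centralS j; rewrite expnS; nia.
Qed.

Lemma Rcb_sqrS j :
  Rcb j.+1 ^+ 2 * (2 * j + 1)%:R ^+ 2 = Rcb j ^+ 2 * (2 * j + 2)%:R ^+ 2.
Proof. by rewrite -!exprMn RcbS. Qed.

Lemma Rcb_sqr_div_noninc i j : (0 < i)%N -> (i <= j)%N ->
  Rcb j ^+ 2 / j%:R <= Rcb i ^+ 2 / i%:R.
Proof.
move=> i0; elim: j => [|j IH]; first by rewrite leqn0 => /eqP i_eq0; lia.
rewrite leq_eqVlt => /predU1P[->//|ij]; apply: le_trans (IH ij).
have j0 : 0 < j%:R :> rat by rewrite ltr0n; lia.
rewrite ler_pdivrMr ?ltr0n // mulrAC ler_pdivlMr //.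
have c0 : 0 < (2 * j + 1)%:R ^+ 2 :> rat by rewrite exprn_gt0 // ltr0n; lia.
rewrite -(ler_pM2r c0) mulrAC Rcb_sqrS.
rewrite -2!(mulrA (Rcb j ^+ 2)) ler_pM2l ?exprn_gt0 ?Rcb_gt0 //.
rewrite -!natrX -!natrM ler_nat; nia.
Qed.

(** The quotient [R_j ^ 2 / (j + c)] does not decrease from [j] to [j + 1]
    exactly when [(j + 1) / (4j + 3) <= c]; the least [c] that works from
    [j = 0] on is 1/3. *)
Lemma Rcb_sqr_div_nondec i j : (i <= j)%N ->
  Rcb i ^+ 2 / (3 * i + 1)%:R <= Rcb j ^+ 2 / (3 * j + 1)%:R.
Proof.
elim: j => [|j IH]; first by rewrite leqn0 => /eqP->.
rewrite leq_eqVlt => /predU1P[->//|ij]; apply: le_trans (IH ij) _.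
rewrite ler_pdivrMr ?ltr0n; last by lia.
rewrite mulrAC ler_pdivlMr ?ltr0n; last by lia.
have c0 : 0 < (2 * j + 1)%:R ^+ 2 :> rat by rewrite exprn_gt0 // ltr0n; lia.
rewrite -(ler_pM2r c0) [leRHS]mulrAC Rcb_sqrS.
rewrite -2!(mulrA (Rcb j ^+ 2)) ler_pM2l ?exprn_gt0 ?Rcb_gt0 //.
rewrite -!natrX -!natrM ler_nat; nia.
Qed.

Lemma omega_gt0 d K : 0 < omega d K.
Proof. by rewrite divr_gt0 ?Rcb_gt0. Qed.

Lemma omega_sqr_le d K : (0 < d)%N -> (0 < K)%N -> omega d K ^+ 2 <= d%:R.
Proof.
move=> d0 K0; rewrite expr_div_n ler_pdivrMr ?exprn_gt0 ?Rcb_gt0 //.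
have := @Rcb_sqr_div_noninc K (d * K) K0; rewrite leq_pmull // => /(_ isT).
rewrite ler_pdivrMr ?ltr0n ?muln_gt0 ?d0 // natrM.
by rewrite mulrA mulrAC divfK ?pnatr_eq0 -?lt0n // mulrC.
Qed.

Lemma omega_sqr_ge d K : (0 < d)%N ->
  (3 * d * K)%:R <= omega d K ^+ 2 * (3 * K + 1)%:R.
Proof.
move=> d0; rewrite expr_div_n mulrAC ler_pdivlMr ?exprn_gt0 ?Rcb_gt0 //.
have := @Rcb_sqr_div_nondec K (d * K); rewrite leq_pmull // => /(_ isT).
rewrite ler_pdivrMr ?ltr0n; last by lia.
rewrite mulrAC ler_pdivlMr ?ltr0n; last by lia.
apply: le_trans; rewrite mulrC ler_pM2l ?exprn_gt0 ?Rcb_gt0 // ler_nat.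
lia.
Qed.

(** * From squared bounds to floors *)

(** The two floor formulas say [A - 2 <= w B < A - 1] and
    [w B <= A < w (B + 1)]; the three last hypotheses give these inequalities
    by comparing squares. *)
Lemma floor_of_sqr_bounds (d K : nat) (A B : int) (w : rat) :
  0 < w -> w ^+ 2 <= d%:R -> (3 * d * K)%:R <= w ^+ 2 * (3 * K + 1)%:R ->
  0 <= B -> 2 <= A ->
  d%:Z * B ^+ 2 < (A - 1) ^+ 2 ->
  A ^+ 2 * (3 * K + 1)%:Z < (3 * d * K)%:Z * (B + 1) ^+ 2 ->
  (A - 2) ^+ 2 * (3 * K + 1)%:Z <= (3 * d * K)%:Z * B ^+ 2 ->
  A = Num.floor (w * B%:~R) + 2 /\ B = Num.floor (A%:~R / w).
Proof.
move=> w0 w2le w2ge B0 A2 h1 h2 h3.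
have K3 : 0 < (3 * K + 1)%:R :> rat by rewrite ltr0n; lia.
have b0 : 0 <= B%:~R :> rat by rewrite ler0z.
have a2 : 2 <= A%:~R :> rat by rewrite (ler_int rat 2).
have g1 : w * B%:~R < A%:~R - 1.
  rewrite -(@ltr_pXn2r _ 2) ?nnegrE ?mulr_ge0 ?(ltW w0) //; last by lra.
  rewrite exprMn.
  apply: (@le_lt_trans _ _ (d%:R * B%:~R ^+ 2)).
    by rewrite ler_wpM2r ?exprn_ge0.
  by move: h1; rewrite -(ltr_int rat) rmorphM /= !rmorphXn /= rmorphB.
have g2 : A%:~R < w * (B%:~R + 1).
  rewrite -(@ltr_pXn2r _ 2) ?nnegrE ?mulr_ge0 ?(ltW w0) //; [|lra|lra].
  rewrite -(ltr_pM2r K3) exprMn [ltRHS]mulrAC.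
  apply: (@lt_le_trans _ _ ((3 * d * K)%:R * (B%:~R + 1) ^+ 2)); last first.
    by rewrite ler_wpM2r // exprn_ge0 //; lra.
  move: h2; rewrite -(ltr_int rat).
  rewrite rmorphM /= rmorphXn /= rmorphM /= rmorphXn /=.
  by rewrite (rmorphD _ B) /=.
have g3 : A%:~R - 2 <= w * B%:~R.
  rewrite -(@ler_pXn2r _ 2) ?nnegrE ?mulr_ge0 ?(ltW w0) //; last by lra.
  rewrite -(ler_pM2r K3) exprMn [leRHS]mulrAC.
  apply: (@le_trans _ _ ((3 * d * K)%:R * (B%:~R) ^+ 2)); last first.
    by rewrite ler_wpM2r // exprn_ge0.
  move: h3; rewrite -(ler_int rat).
  rewrite rmorphM /= rmorphXn /= rmorphM /= rmorphXn /=.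
  by rewrite (rmorphB _ A) /=.
split.
  rewrite (@floor_def _ _ (A - 2)) ?subrK //.
  rewrite !intrD; apply/andP; split; lra.
symmetry; apply: floor_def; rewrite ler_pdivlMr // ltr_pdivrMr //.
rewrite rmorphD /= mulrC; apply/andP; split; first by lra.
by rewrite mulrC.
Qed.

Theorem theorem3 (d K : nat) (X1 Y1 : int)
    (hd : (2 <= d)%N)
    (hnsq : ~ exists m : nat, d = (m ^ 2)%N)
    (hfund : fundamental_sol d X1 Y1)
    (hK : X1 < K%:Z) :
  let A : int := pell_xsum d K in
  let B : int := pell_ysum d K in
  let w : rat := omega d K in
  A = Num.floor (w * B%:~R) + 2 /\ B = Num.floor (A%:~R / w).
Proof.
move=> A B w; have [X0 Y0 hXY _] := hfund.
have d0 : (0 < d)%N by lia.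
have dz0 : 0 < d%:Z by lia.
have K0 : (0 < K)%N by lia.
have hX := fundamental_gt1 dz0 X0 Y0 hXY.
have [N hN] : exists N, (pell d X1 Y1 N.+1).1 < K%:Z <= (pell d X1 Y1 N.+2).1.
  pose P n := (pell d X1 Y1 n.+1).1 < K%:Z.
  have exP : exists n, P n by exists 0%N; rewrite /P /= mulr1 mulr0 addr0.
  have ubP n : P n -> (n <= K)%N.
    by rewrite /P => h; have := ltn_pell n.+1 (ltW dz0) hX Y0; lia.
  case: (ex_maxnP exP ubP) => N PN maxN; exists N; rewrite [X in X && _]PN /=.
  by rewrite leNgt; apply/negP => /(maxN N.+1); rewrite ltnn.
have hA : A = \sum_(n < N.+2) (pell d X1 Y1 n).1.
  exact: (sum_box_pell (fun x _ => x) d0 hfund hN).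
have hB : B = \sum_(n < N.+2) (pell d X1 Y1 n).2.
  exact: (sum_box_pell (fun _ y => y) d0 hfund hN).
have [e1 e2] := @pell_sum_xy d X1 Y1 N.+1 dz0 Y0 hXY.
have /eqP hn := pell_solP N.+1 hXY; move/eqP: (hXY) => hN1.
have sA := pell_sum_x N.+1 hN1; have sB := pell_sum_y N.+1 hN1.
have xA := @pell_sum_x_ge d X1 Y1 N (ltW dz0) X0 Y0.
have [x0 y0] := @pell_ge0 d X1 Y1 N.+1 (ltW dz0) X0 Y0.
have B0 : 0 <= B.
  rewrite hB sumr_ge0 // => k _.
  by have [] := @pell_ge0 d X1 Y1 k (ltW dz0) X0 Y0.
have x2 := @ltn_pell d X1 Y1 N.+1 (ltW dz0) hX Y0.
rewrite -hA -hB in e1 e2 sA sB xA.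
move: (pell d X1 Y1 N.+1).1 (pell d X1 Y1 N.+1).2 hN hn e1 e2 sA sB xA x0 y0 x2.
move=> x y /andP[xK _] hn e1 e2 sA sB xA x0 y0 x2.
have A8 : 8 * A <= 11 * x + 4.
  have := fundamental_ratio_ub dz0 hX Y0 x0 y0 hN1 hn.
  by move=> h; rewrite -(ler_pM2l Y0); lra.
have B2 : 2 * B <= x + y - 1.
  have dY0 : 0 < d%:Z * Y1 by rewrite mulr_gt0.
  have dge2 : 2 <= d%:Z by lia.
  have := fundamental_le_dY dge2 hX Y0 hN1.
  rewrite -subr_ge0 => h.
  have : 0 <= (d%:Z * Y1 - (X1 + 1)) * (x - 1) by rewrite mulr_ge0 //; lia.
  by move=> h'; rewrite -(ler_pM2l dY0); lra.
have [| | |c1 c2 c3] := @sqr_bounds d K x y A B _ _ _ y0 B0 hn e1 e2 xA A8 B2.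
- by lia.
- by lia.
- by lia.
apply: floor_of_sqr_bounds B0 _ c1 _ _.
- exact: omega_gt0.
- exact: omega_sqr_le.
- exact: omega_sqr_ge.
- by lia.
- by move: c2; rewrite !PoszM !PoszD.
- by move: c3; rewrite !PoszM !PoszD.
Qed.
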